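(* Let $G$ be a finitely generated residually finite group with $\nabla G>0$, and let $R$ be a subgroup of infinite index in $G$ such that for every finitely generated subgroup $L$ of infinite index in $G$ we have $[L:L\cap R]<\infty$. Then the kernel $K$ of the right action of $G$ on the set of right cosets $R\backslash G=\{Rg: g\in G\}$ (i.e. the set of $g\in G$ fixing every coset) is finite.
   Context: For a group $U$, $d(U)$ denotes the minimal cardinality of a generating set of $U$. The rank gradient of a finitely generated group $G$ is $\nabla G=\inf_U \frac{d(U)-1}{[G:U]}$, where $U$ ranges over all finite index subgroups of $G$. *)

(* Defs.v *)
From HB Require Import structures.
From mathcomp Require Import all_boot all_order all_algebra.
From mathcomp Require Import classical_sets reals.
From mathcomp Require Import Rstruct.
From Stdlib Require Import List.

Set Implicit Arguments.
Unset Strict Implicit.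
Unset Printing Implicit Defensive.

Import Order.TTheory GRing.Theory Num.Theory.

Record group := Group {
  carrier :> Type;
  gmul : carrier -> carrier -> carrier;
  gone : carrier;
  ginv : carrier -> carrier;
  gmulA : forall x y z, gmul x (gmul y z) = gmul (gmul x y) z;
  gmul1 : forall x, gmul gone x = x;
  gmulV : forall x, gmul (ginv x) x = gone
}.

Section GroupDefs.
Variable G : group.

Definition subgroup (H : G -> Prop) : Prop :=
  H (gone G) /\ (forall x y, H x -> H y -> H (gmul x y)) /\
  (forall x, H x -> H (ginv x)).

Definition normal (N : G -> Prop) : Prop :=
  subgroup N /\ forall g x, N x -> N (gmul (ginv g) (gmul x g)).

Definition gen (s : list G) (x : G) : Prop :=
  forall H, subgroup H -> (forall y, In y s -> H y) -> H x.

Definition generates (U : G -> Prop) (s : list G) : Prop :=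
  (forall y, In y s -> U y) /\ (forall x, U x -> gen s x).

Definition fin_generated (U : G -> Prop) : Prop := exists s, generates U s.

Definition min_gens (U : G -> Prop) (n : nat) : Prop :=
  (exists s, generates U s /\ length s = n) /\
  (forall s, generates U s -> n <= length s).

(* Right cosets: H x = H y  iff  x y^-1 in H. *)
(* [L : H] = n (for H contained in L): there are exactly n right cosets of H
   in L, given by representatives r : 'I_n -> L. *)
Definition rel_index_is (L H : G -> Prop) (n : nat) : Prop :=
  exists r : 'I_n -> G,
    (forall i, L (r i)) /\
    (forall i j, H (gmul (r i) (ginv (r j))) -> i = j) /\
    (forall x, L x -> exists i, H (gmul x (ginv (r i)))).

Definition rel_finite_index (L H : G -> Prop) : Prop :=
  exists n, rel_index_is L H n.

Definition index_is (U : G -> Prop) (n : nat) : Prop :=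
  rel_index_is (fun _ => True) U n.

Definition finite_index (U : G -> Prop) : Prop := exists n, index_is U n.

Definition finitely_generated : Prop := fin_generated (fun _ => True).

Definition residually_finite : Prop :=
  forall g : G, g <> gone G ->
    exists N, normal N /\ finite_index N /\ ~ N g.

Definition rank_gradient : Rdefinitions.R :=
  inf [set r : Rdefinitions.R | exists U d n,
        subgroup U /\ index_is U n /\ min_gens U d /\
        r = ((d%:R - 1) / n%:R)%R].

(* Kernel of the right action of G on R\G: g with R x g = R x for all x,
   i.e. x g x^-1 in R for all x. *)
Definition coset_action_kernel (R : G -> Prop) (g : G) : Prop :=
  forall x, R (gmul x (gmul g (ginv x))).

Definition finite_set (K : G -> Prop) : Prop :=
  exists s : list G, forall g, K g -> In g s.

End GroupDefs.

(* Main.v *)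
Require Import Defs.
From HB Require Import structures.
From mathcomp Require Import all_boot all_order all_algebra.
From mathcomp Require Import classical_sets reals Rstruct.
From mathcomp Require Import boolp.
From mathcomp Require Import lra.
From Stdlib Require Import List.
Import Order.TTheory GRing.Theory Num.Theory.

(** Suppose the kernel [K] is infinite.  If [L] is finitely generated and [KL]
    has finite index, then so has [L]: otherwise [L] is virtually contained in
    [R], hence finitely many right cosets of [R], which contains [K], cover
    [KL], and then [G].  Now let [U] be any subgroup of finite index, let
    [V = KU] and [m = [G : V]].  By Schreier, [V] has at most [m (d + 1)]
    generators; their components in [U] generate a subgroup [L] of [U] with
    [KL = V].  So [L] has finite index, and
    [grad G * [G : U] <= grad G * [G : L] <= m (d + 1)], that is,
    [grad G * [KU : U] <= d + 1].  But by residual finiteness [[KU : U]] is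
    unbounded when [K] is infinite. *)

Set Implicit Arguments.
Unset Strict Implicit.
Unset Printing Implicit Defensive.

Local Notation "x ** y" := (gmul x y) (at level 40, left associativity).

Lemma mem_In (T : eqType) (x : T) (s : list T) : x \in s -> In x s.
Proof.
elim: s => //= y s IHs; rewrite inE => /orP[/eqP ->|/IHs]; first by left.
by right.
Qed.

Lemma length_enum_ord n : length (enum 'I_n) = n.
Proof. exact: size_enum_ord. Qed.

Section GroupTheory.
Variable G : group.
Implicit Types (x y z g : G) (U V H K L : G -> Prop).

(** * Group identities and generated subgroups *)

Lemma gmulVr x : x ** ginv x = gone G.
Proof.
rewrite -[LHS]gmul1 -{1}(gmulV (ginv x)) -gmulA (gmulA (ginv x) x).
by rewrite gmulV gmul1 gmulV.
Qed.

Lemma gmul1r x : x ** gone G = x.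
Proof. by rewrite -(gmulV x) gmulA gmulVr gmul1. Qed.

Lemma gmulKV x y : x ** (ginv x ** y) = y.
Proof. by rewrite gmulA gmulVr gmul1. Qed.

Lemma gmulVK x y : ginv x ** (x ** y) = y.
Proof. by rewrite gmulA gmulV gmul1. Qed.

Lemma ginvK x : ginv (ginv x) = x.
Proof. by rewrite -[LHS]gmul1r -(gmulV x) gmulVK. Qed.

Lemma ginv1 : ginv (gone G) = gone G.
Proof. by rewrite -[LHS]gmul1 gmulVr. Qed.

Lemma ginvM x y : ginv (x ** y) = ginv y ** ginv x.
Proof.
by rewrite -[LHS](gmulVK y) -[y ** _](gmulVK x) (gmulA x y) gmulVr gmul1r.
Qed.

Lemma gmulrI x y : x ** ginv y = gone G -> x = y.
Proof. by move=> e; rewrite -[x]gmul1r -(gmulV y) gmulA e gmul1. Qed.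

(** Words are bracketed to the right and adjacent inverses cancelled; the coset computations below
    end with this reduction. *)
Let gsimp :=
  (ginvM, ginvK, ginv1, gmulKV, gmulVK, gmulV, gmulVr, gmul1, gmul1r).
Ltac gsimpl := repeat (rewrite -?gmulA ?gsimp).

Lemma gen_subgroup (s : list G) : subgroup (gen s).
Proof.
split; first by move=> H [].
split=> [x y hx hy H sH hs | x hx H sH hs].
  by case: (sH) => _ [sM _]; apply: sM; [apply: hx | apply: hy].
by case: (sH) => _ [_ sV]; apply: sV; apply: hx.
Qed.

Lemma gen_in (s : list G) x : In x s -> gen s x.
Proof. by move=> xs H _; apply. Qed.

Lemma generates_gen (s : list G) : generates (gen s) s.
Proof. by split=> // y; apply: gen_in. Qed.

(** * Cosets and finite index *)

Lemma index_gt0 U n : index_is U n -> 0 < n.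
Proof. by case: n => // -[r [_ [_ /(_ (gone G) I)[[]]]]]. Qed.

Lemma index_repr U n : index_is U n -> exists r : 'I_n -> G,
  exists f : G -> 'I_n,
    (forall i j, U (r i ** ginv (r j)) -> i = j) /\
    (forall x, U (x ** ginv (r (f x)))).
Proof.
case=> r [_ [r_inj r_cov]].
have [f hf] := choice (fun x => r_cov x I).
by exists r, f.
Qed.

(** The list may repeat cosets; an element is kept only if its coset is not yet represented. *)
Lemma index_of_cover U (l : list G) : subgroup U ->
  (forall x, exists2 y, In y l & U (x ** ginv y)) -> finite_index U.
Proof.
move=> [U1 [UM UV]] l_cov.
have [n [r [r_inj r_cov]]] : exists n, exists r : 'I_n -> G,
    (forall i j, U (r i ** ginv (r j)) -> i = j) /\
    (forall x, In x l -> exists i, U (x ** ginv (r i))).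
  elim: l {l_cov} => [|a l [n [r [r_inj r_cov]]]].
    by exists 0, (fun=> gone G); split=> // -[].
  have [[i ai]|na] := pselect (exists i, U (a ** ginv (r i))).
    by exists n, r; split=> // x [<-|/r_cov //]; exists i.
  exists n.+1, (fun i => if unlift ord0 i is Some j then r j else a).
  split=> [i j|x [<-|/r_cov[i xi]]]; last 2 first.
  - by exists ord0; rewrite unlift_none gmulVr.
  - by exists (lift ord0 i); rewrite liftK.
  case: unliftP => [i'|] ->; case: unliftP => [j'|] -> //.
  - by move/r_inj ->.
  - move=> h; case: na; exists i'.
    by have := UV _ h; gsimpl.
  - by move=> h; case: na; exists j'.
exists n, r; split=> //; split=> // x _.
have [y /r_cov[i yi] xy] := l_cov x.
by exists i; have := UM _ _ xy yi; gsimpl.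
Qed.

(** One preimage for each attained value of [f] gives a finite covering list. *)
Lemma index_of_fin_invariant (T : finType) (f : G -> T) U : subgroup U ->
  (forall x y, f x = f y -> U (x ** ginv y)) -> finite_index U.
Proof.
move=> sU f_sep.
have [l hl] : exists l : list G, forall x, f x \in enum T ->
    exists2 y, In y l & f x = f y.
  elim: (enum T) => [|t s [l hl]]; first by exists nil.
  have [[a fa]|na] := pselect (exists a, f a = t).
    exists (a :: l) => x; rewrite inE => /orP[/eqP ->|/hl[y yl ->]].
      by exists a; [left | rewrite fa].
    by exists y => //; right.
  by exists l => x; rewrite inE => /orP[/eqP fx|/hl //]; case: na; exists x.
apply: (@index_of_cover _ l) => // x.
have [|y yl /f_sep] := hl x; first by rewrite mem_enum.
by exists y.
Qed.

Lemma subgroupI U V : subgroup U -> subgroup V ->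
  subgroup (fun x => U x /\ V x).
Proof.
move=> [U1 [UM UV]] [V1 [VM VV]]; split=> //.
by split=> [x y [? ?] [? ?]|x [? ?]]; split; auto.
Qed.

Lemma finite_indexI U V : subgroup U -> subgroup V ->
  finite_index U -> finite_index V -> finite_index (fun x => U x /\ V x).
Proof.
move=> sU sV [n /index_repr[r [f [_ hf]]]] [p /index_repr[q [g [_ hg]]]].
(* The cosets of [x] modulo [U] and modulo [V] together determine its coset modulo the
   intersection. *)
apply: (@index_of_fin_invariant _ (fun x => (f x, g x))).
  exact: subgroupI.
move=> x y [fxy gxy].
case: sU sV => _ [UM UV] [_ [VM VV]]; split.
- have := UV _ (hf y); rewrite -fxy => /(UM _ _ (hf x)); by gsimpl.
- have := VV _ (hg y); rewrite -gxy => /(VM _ _ (hg x)); by gsimpl.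
Qed.

Lemma finite_index_sup U V : subgroup V -> (forall x, U x -> V x) ->
  finite_index U -> finite_index V.
Proof.
move=> sV UV [n /index_repr[r [f [_ hf]]]].
apply: (@index_of_cover _ (map r (enum 'I_n))) => // x.
exists (r (f x)); last exact/UV/hf.
by apply: in_map; apply: mem_In; rewrite mem_enum.
Qed.

Lemma finite_indexT : finite_index (fun _ : G => True).
Proof.
by apply: (@index_of_cover _ [:: gone G]) => // x; exists (gone G) => //; left.
Qed.

Lemma residually_finite_separates (l : list G) : residually_finite G ->
  exists U, subgroup U /\ finite_index U /\
    forall g, In g l -> U g -> g = gone G.
Proof.
move=> rf; elim: l => [|a l [U [sU [fU hU]]]].
  by exists (fun=> True); split=> //; split=> //; apply: finite_indexT.
have [->|/rf[N [[sN _] [fN Na]]]] := pselect (a = gone G).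
  by exists U; split=> //; split=> // g [<-|/hU].
exists (fun x => U x /\ N x); split; first exact: subgroupI.
split; first exact: finite_indexI.
by move=> g [<- [_ /Na]|gl [/(hU _ gl)]].
Qed.

(** * Generators of finite index subgroups *)

Lemma schreier_generators V (m : nat) (s : list G) :
  subgroup V -> index_is V m -> generates (fun=> True) s ->
  exists t, generates V t /\ length t <= m * (length s).+1.
Proof.
move=> [V1 [VM VV]] iV [_ gs]; have m_gt0 := index_gt0 iV.
have [r [f [r_inj hf]]] := index_repr iV.
(* The representative [r i0] of the coset [V] need not be the identity; it joins [t] so that
   conjugation by it can be undone. *)
pose i0 := f (gone G).
have Vr0 : V (r i0) by have := VV _ (hf (gone G)); gsimpl.
pose sg i x := r i ** x ** ginv (r (f (r i ** x))).
pose t := r i0 :: flat_map (fun i => map (sg i) s) (enum 'I_m).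
have in_t i x : In x s -> In (sg i x) t.
  move=> xs; right; apply/in_flat_map; exists i; split; last exact: in_map.
  by apply: mem_In; rewrite mem_enum.
exists t; split; last first.
  rewrite /= (@flat_map_constant_length _ _ (length s)); last first.
    by move=> i _; rewrite length_map.
  (* The length is [m * length s + 1], and [m_gt0] absorbs the 1. *)
  by rewrite length_enum_ord multE mulnS -addn1 addnC leq_add2r.
split=> [y|w Vw].
  by case=> [<- //|/in_flat_map[i [_ /in_map_iff[x [<- _]]]]]; apply: hf.
have [H1 [HM HV]] := gen_subgroup t.
(* [T] is a subgroup containing [s], hence is all of [G]; for [w] in [V] it
   puts the conjugate [r i0 ** w ** ginv (r i0)] in the span of [t]. *)
pose T y := forall i j, V (r i ** y ** ginv (r j)) ->
  gen t (r i ** y ** ginv (r j)).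
have key y : T y.
  apply: (gs y I T); last first.
    (* Distinct representatives lie in distinct cosets, so [j] is forced and the element is the
       generator [sg i y]. *)
    move=> {}y ys i j Vij; have -> : j = f (r i ** y).
      by apply: r_inj; have := VM _ _ (VV _ Vij) (hf (r i ** y)); gsimpl.
    exact: gen_in (in_t i y ys).
  split=> [i j|].
    by rewrite gmul1r => /r_inj ->; rewrite gmulVr.
  split=> [{}y z hy hz i j Vij|{}y hy i j Vij].
    (* The product is split at [r k], which represents the coset reached after [y]. *)
    have Vk := hf (r i ** y); set k := f _ in Vk.
    have Vkj : V (r k ** z ** ginv (r j)).
      by have := VM _ _ (VV _ Vk) Vij; gsimpl.
    by have := HM _ _ (hy _ _ Vk) (hz _ _ Vkj); gsimpl.
  have Vji : V (r j ** y ** ginv (r i)) by have := VV _ Vij; gsimpl.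
  by have := HV _ (hy _ _ Vji); gsimpl.
have H0 : gen t (r i0) by apply: gen_in; left.
have := key w i0 i0 (VM _ _ (VM _ _ Vr0 Vw) (VV _ Vr0)).
by move=> h; have := HM _ _ (HV _ H0) (HM _ _ h H0); gsimpl.
Qed.

Lemma infinite_set_NoDup K n : ~ finite_set K ->
  exists l, [/\ NoDup l, length l = n & forall x, In x l -> K x].
Proof.
move=> infK; elim: n => [|n [l [ul sl lK]]].
  by exists nil; split=> //; constructor.
have [x nx] : exists x, ~ (K x -> In x l).
  by apply/existsNP => h; apply: infK; exists l.
move/not_implyP: nx => [Kx xl].
exists (x :: l); split=> [||y [<- //|/lK //]]; first by constructor.
by rewrite /= sl.
Qed.

(** * The kernel and its products with subgroups *)

Lemma coset_action_kernel_subgroup V : subgroup V ->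
  subgroup (coset_action_kernel V).
Proof.
move=> [V1 [VM VV]]; split=> [x|]; first by gsimpl.
split=> [g h hg hh x|g hg x].
  by have := VM _ _ (hg x) (hh x); gsimpl.
by have := VV _ (hg x); gsimpl.
Qed.

Lemma coset_action_kernelJ V g x :
  coset_action_kernel V g -> coset_action_kernel V (x ** g ** ginv x).
Proof. by move=> hg y; have := hg (y ** x); gsimpl. Qed.

Lemma coset_action_kernel_sub V g : coset_action_kernel V g -> V g.
Proof. by move/(_ (gone G)); gsimpl. Qed.

Definition prodset K U g := exists2 u, U u & K (g ** ginv u).

Lemma prodset_subgroup K U : subgroup K -> subgroup U ->
  (forall x g, K g -> K (x ** g ** ginv x)) ->
  subgroup (prodset K U).
Proof.
move=> [K1 [KM KV]] [U1 [UM UV]] KJ; split.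
  by exists (gone G) => //; gsimpl.
split=> [x y [u Uu Ku] [v Uv Kv]|x [u Uu Ku]].
  exists (u ** v); first exact: UM.
  by have := KM _ _ Ku (KJ u _ Kv); gsimpl.
exists (ginv u); first exact: UV.
by have := KJ (ginv u) _ (KV _ Ku); gsimpl.
Qed.

(** Write x = k l r with r a representative modulo KL, and l = v t with v in [V]. As k is in [V]
    too, the finitely many products t r meet every coset of [V]. *)
Lemma finite_index_of_prodset K L V : subgroup V ->
  (forall x, K x -> V x) -> rel_finite_index L (fun x => L x /\ V x) ->
  finite_index (prodset K L) -> finite_index V.
Proof.
move=> sV KV [p [t [_ [_ ht]]]] [m /index_repr[r [f [_ hf]]]].
pose c ij := t (fst ij) ** r (snd ij).
apply: (@index_of_cover _ (map c (enum {: 'I_p * 'I_m}))) => // x.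
have [l Ll Kl] := hf x; have [i [_ Vi]] := ht l Ll.
exists (c (i, f x)).
  by apply: in_map; apply: mem_In; rewrite mem_enum.
case: sV => _ [VM _].
by rewrite /c /=; have := VM _ _ (KV _ Kl) Vi; gsimpl.
Qed.

(** This is [G : L] >= [G : KU] [KU : U], with [length l] as a lower bound for the last factor: the
    products of elements of [l] with representatives modulo KU lie in distinct cosets of [U], hence
    of [L]. *)
Lemma leq_index_prodset K U L m n (l : list G) :
  subgroup K -> subgroup U -> subgroup (prodset K U) ->
  (forall x, L x -> U x) ->
  index_is (prodset K U) m -> index_is L n ->
  NoDup l -> (forall x, In x l -> K x) ->
  (forall x y, In x l -> In y l -> U (x ** ginv y) -> x = y) ->
  length l * m <= n.
Proof.
move=> [K1 [KM KV]] [U1 [UM UV]] [V1 [VM VV]] LU.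
move=> /index_repr[r [_ [r_inj _]]] /index_repr[q [f [_ hf]]] ul lK lU.
have sKV x : K x -> prodset K U x by exists (gone G) => //; gsimpl.
have sUV x : U x -> prodset K U x by move=> Ux; exists x => //; gsimpl.
pose k (i : 'I_(length l)) := nth i l (gone G).
have kl i : In (k i) l by apply: nth_In; apply/ssrnat.ltP.
pose F (ij : 'I_(length l) * 'I_m) := f (k ij.1 ** r ij.2).
suff /leq_card : injective F by rewrite card_prod !card_ord.
move=> [i j] [i' j']; rewrite /F /= => eF.
have Ux : U (k i ** r j ** ginv (r j') ** ginv (k i')).
  have := UM _ _ (LU _ (hf (k i ** r j))) (UV _ (LU _ (hf (k i' ** r j')))).
  by rewrite eF; gsimpl.
(* Stripping [k i] and [k i'], which lie in KU, leaves [r j ** ginv (r j')] in KU. *)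
have ej : j = j'.
  apply: r_inj.
  have := VM _ _ (VV _ (sKV _ (lK _ (kl i))))
    (VM _ _ (sUV _ Ux) (sKV _ (lK _ (kl i')))).
  by gsimpl.
rewrite -ej in Ux *; congr (_, _); apply: val_inj.
apply: (proj1 (NoDup_nth l (gone G)) ul).
- exact/ssrnat.ltP/ltn_ord.
- exact/ssrnat.ltP/ltn_ord.
- by apply: (lU _ _ (kl i) (kl i')); move: Ux; gsimpl.
Qed.

(** * Bounds from the rank gradient *)

Lemma min_gens_exists U (s : list G) : generates U s ->
  exists2 d, min_gens U d & d <= length s.
Proof.
move=> gs.
have ex : exists n, `[< exists s, generates U s /\ length s = n >].
  by exists (length s); apply/asboolP; exists s.
case: (ex_minnP ex) => d /asboolP hd dmin; exists d; last first.
  by apply: dmin; apply/asboolP; exists s.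
by split=> // t gt; apply: dmin; apply/asboolP; exists t.
Qed.

Lemma rank_gradient_le U n (s : list G) :
  subgroup U -> index_is U n -> generates U s ->
  (rank_gradient G * n%:R <= (length s)%:R)%R.
Proof.
move=> sU iU gs; have [d dmin ds] := min_gens_exists gs.
have n_gt0 : (0 < n%:R :> Rdefinitions.R)%R by rewrite ltr0n (index_gt0 iU).
apply: (@le_trans _ _ (d%:R - 1)%R); last first.
  by rewrite -(ler_nat Rdefinitions.R) in ds; lra.
rewrite -ler_pdivlMr //; apply: ge_inf; last by exists U, d, n.
(* [ge_inf] asks for a lower bound of the set; 0 would fail when [d' = 0]. *)
exists (-1)%R => _ [U' [d' [n' [_ [/index_gt0 n'_gt0 [_ ->]]]]]].
have n'1 : (1 <= n'%:R :> Rdefinitions.R)%R by rewrite ler1n.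
rewrite ler_pdivlMr; last by lra.
have : (0 <= d'%:R :> Rdefinitions.R)%R by [].
lra.
Qed.

End GroupTheory.

(** * Finiteness of the kernel *)

Theorem theorem4p2 (G : group) (R : G -> Prop) :
  finitely_generated G ->
  residually_finite G ->
  (0 < rank_gradient G)%R ->
  subgroup R ->
  ~ finite_index R ->
  (forall L : G -> Prop, subgroup L -> fin_generated L -> ~ finite_index L ->
     rel_finite_index L (fun x => L x /\ R x)) ->
  finite_set (coset_action_kernel R).
Proof.
move=> [s gs] rf grad_gt0 sR infR hR; apply: contrapT => infK.
set K := coset_action_kernel R in infK.
have sK : subgroup K by apply: coset_action_kernel_subgroup.
have KJ x g : K g -> K (x ** g ** ginv x) by apply: coset_action_kernelJ.
(* [N] will bound [KU : U] from below; this size makes the final count contradictory. *)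
have [N hN] : exists N, ((length s).+1%:R < rank_gradient G * N%:R)%R.
  exists (Num.bound ((length s).+1%:R / rank_gradient G)%R).
  by rewrite mulrC -ltr_pdivrMr // archi_boundP // divr_ge0 // ltW.
have [l [ul szl lK]] := infinite_set_NoDup N infK.
(* [U] avoids all nontrivial quotients of elements of [l], which thus stay in distinct cosets. *)
have [U [sU [fU hU]]] := residually_finite_separates
  (map (fun p => fst p ** ginv (snd p)) (list_prod l l)) rf.
have lU x y : In x l -> In y l -> U (x ** ginv y) -> x = y.
  move=> xl yl /hU h; apply: gmulrI; apply: h.
  by apply: (in_map (fun p => fst p ** ginv (snd p)) _ (x, y)); apply: in_prod.
have sV : subgroup (prodset K U) by apply: prodset_subgroup.
have [m iV] : finite_index (prodset K U).
  apply: finite_index_sup fU => // x Ux; exists x => //.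
  by rewrite gmulVr; case: sK.
have [t [[tV gt] szt]] := schreier_generators sV iV gs.
(* [u y] is a component of [y] in [U]; outside KU its value is arbitrary. *)
have /choice[u hu] : forall y, exists v,
    prodset K U y -> U v /\ K (y ** ginv v).
  move=> y; have [[v Uv Kv]|ny] := pselect (prodset K U y); first by exists v.
  by exists y.
pose L := gen (map u t).
have sL : subgroup L by apply: gen_subgroup.
have LU x : L x -> U x.
  by apply=> // _ /in_map_iff[y [<- /tV/hu[]]].
(* KL is a subgroup, so it is enough that it contains the generators [t] of KU. *)
have VL x : prodset K U x -> prodset K L x.
  move=> /gt; apply; first exact: prodset_subgroup.
  move=> y yt; exists (u y); first exact: gen_in (in_map u _ _ yt).
  by case: (hu y (tV y yt)).
have [n iL] : finite_index L.
  apply: contrapT => infL; apply: infR.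
  apply: (@finite_index_of_prodset _ K L) => //.
  - exact: coset_action_kernel_sub.
  - by apply: hR => //; exists (map u t); apply: generates_gen.
  - by apply: (finite_index_sup _ VL); [apply: prodset_subgroup | exists m].
have := leq_index_prodset sK sU sV LU iV iL ul lK lU; rewrite szl => Nmn.
have := rank_gradient_le sL iL (generates_gen _); rewrite length_map.
apply/negP; rewrite -ltNge.
have m_gt0 : (0 < m%:R :> Rdefinitions.R)%R by rewrite ltr0n (index_gt0 iV).
(* With d = [length s] and grad the rank gradient, the chain is [length t] <= m (d + 1) < grad N m
   <= grad n. *)
apply: (@lt_le_trans _ _ (rank_gradient G * (N * m)%:R)%R); last first.
  by rewrite ler_pM2l // ler_nat.
rewrite natrM mulrA; apply: (@le_lt_trans _ _ (m%:R * (length s).+1%:R)%R).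
  by rewrite -natrM ler_nat.
by rewrite mulrC ltr_pM2r.
Qed.
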